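(* Let $F$ be a bipartite graph with $\chi(F)=2$. If $F$ is not a star, then $\mathrm{ex}_q(n,F)=(1+o(1))n$ as $n\to\infty$. If $F$ is the star $K_{1,t}$, then $\mathrm{ex}_q(n,F)=2(t-1)$ for all $n\ge t$.
   Context: All graphs are finite and simple. For a graph $G$, its signless Laplacian matrix is $Q(G)=D(G)+A(G)$, where $D(G)$ is the diagonal matrix of vertex degrees and $A(G)$ is the adjacency matrix; $q(G)$ denotes the largest eigenvalue of $Q(G)$. A graph is $F$-free if it contains no subgraph isomorphic to $F$. Define $\mathrm{ex}_q(n,F)=\max\{q(G): G \text{ has } n \text{ vertices and is } F\text{-free}\}$. $K_{1,t}$ is the star with $t$ leaves. Here $F$ is fixed and $o(1)$ denotes a quantity tending to $0$ as $n\to\infty$.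
   Formalization: ''F is not a star'' is strengthened to ''F is not a star together with isolated vertices'', because for F = K_{1,t} plus s ≥ 1 isolated vertices one has ex_q(n,F) = 2(t-1) for all large n, so the claim (1+o(1))n fails there. *)

(* Defs.v *)
From HB Require Import structures.
From mathcomp Require Import all_boot all_order all_algebra.
From mathcomp Require Import complex.
From mathcomp Require Import finmap.
From mathcomp Require Import all_classical all_reals all_analysis.

Set Implicit Arguments.
Unset Strict Implicit.
Unset Printing Implicit Defensive.

Import Order.TTheory GRing.Theory Num.Theory.
Import numFieldNormedType.Exports.

Local Open Scope classical_set_scope.
Local Open Scope ring_scope.

Record sgraph := SGraph {
  vertex :> finType;
  edge : rel vertex;
  edge_sym : symmetric edge;
  edge_irr : irreflexive edge }.

Notation "x -- y" := (edge x y) (at level 30, no associativity).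

Definition isomorphic (F G : sgraph) : Prop :=
  exists2 f : F -> G, bijective f & forall x y, f x -- f y = x -- y.

(* G has a (not necessarily induced) subgraph isomorphic to F. *)
Definition contains (G F : sgraph) : Prop :=
  exists2 f : F -> G, injective f & forall x y, x -- y -> f x -- f y.

Definition free_of (F G : sgraph) : Prop := ~ contains G F.

Section Coloring.
Variable F : sgraph.

Definition colorable (k : nat) : bool :=
  [exists c : {ffun F -> 'I_k}, [forall x, forall y, (x -- y) ==> (c x != c y)]].

Lemma colorable_card : exists k, colorable k.
Proof.
exists #|F|; apply/existsP; exists [ffun x => enum_rank x].
apply/forallP => x; apply/forallP => y; apply/implyP => xy; rewrite !ffunE.
apply/eqP => /enum_rank_inj eqxy.
by move: xy; rewrite eqxy edge_irr.
Qed.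

Definition chromatic_number : nat := ex_minn colorable_card.

Definition bipartite : Prop :=
  exists A : {set F}, forall x y, x -- y -> (x \in A) != (y \in A).

End Coloring.

Section CompleteBipartite.
Variables s t : nat.

Definition Kmn_edge (x y : 'I_s + 'I_t) : bool :=
  match x, y with
  | inl _, inr _ | inr _, inl _ => true
  | _, _ => false
  end.

Lemma Kmn_sym : symmetric Kmn_edge. Proof. by case=> ? []. Qed.
Lemma Kmn_irr : irreflexive Kmn_edge. Proof. by case. Qed.

Definition Kmn : sgraph := SGraph Kmn_sym Kmn_irr.

End CompleteBipartite.

Definition star (t : nat) : sgraph := Kmn 1 t.

Section AddIsolated.
Variables (G : sgraph) (s : nat).

Definition add_isolated_edge (x y : G + 'I_s) : bool :=
  match x, y with
  | inl u, inl v => u -- v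
  | _, _ => false
  end.

Lemma add_isolated_sym : symmetric add_isolated_edge.
Proof. by case=> ? [] //= ?; exact: edge_sym. Qed.
Lemma add_isolated_irr : irreflexive add_isolated_edge.
Proof. by case=> //= ?; exact: edge_irr. Qed.

Definition add_isolated : sgraph := SGraph add_isolated_sym add_isolated_irr.

End AddIsolated.

(* Isolated vertices of F do not affect F-freeness of graphs on at least #|F|
   vertices: for F = K_{1,t} + s K_1 and n >= #|F|, ex_q(n,F) = 2(t-1).  Hence
   "not a star" in the linear-growth case is read up to isolated vertices. *)
Definition star_upto_isolated (F : sgraph) : Prop :=
  exists t s, isomorphic F (add_isolated (star t) s).

Section SignlessLaplacian.
Variables (R : realType) (G : sgraph).

Definition degree (x : G) : nat := #|[pred y | x -- y]|.

Definition adjacency_mx : 'M[R]_#|G| :=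
  \matrix_(i, j) (enum_val i -- enum_val j)%:R.

Definition degree_mx : 'M[R]_#|G| :=
  diag_mx (\row_i (degree (enum_val i))%:R).

Definition signless_laplacian : 'M[R]_#|G| := degree_mx + adjacency_mx.

End SignlessLaplacian.

(* The greatest element of A; 0 if there is none. *)
Definition setmax (R : realType) (A : set R) : R :=
  xget 0 [set x | A x /\ ubound A x].

Definition qrad (R : realType) (G : sgraph) : R :=
  setmax [set a | eigenvalue (signless_laplacian R G) a].

Definition ex_q (R : realType) (n : nat) (F : sgraph) : R :=
  setmax [set r | exists G : sgraph, [/\ #|G| = n, free_of F G & r = qrad R G]].

(* The maxima in [qrad] and [ex_q] are attained, so the default value of
   [setmax] is only used for n = 0 or when F has no edge. *)

Lemma setmaxP (R : realType) (A : set R) : finite_set A -> A !=set0 ->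
  A (setmax A) /\ ubound A (setmax A).
Proof.
move=> /finite_fsetP[X ->] [x0 /= x0X].
suff /(xgetPex 0) : exists x, [set x | x \in X /\ ubound [set` X] x] x by [].
pose m : X := [arg max_(i > [` x0X]%fset) val i]%O.
exists (val m); split; first exact: valP.
move=> y yX; rewrite /m; case: arg_maxP => //= i _ /(_ [` yX]%fset isT).
exact.
Qed.

Lemma finite_eigenvalue (R : realType) n (A : 'M[R]_n) :
  finite_set [set a | eigenvalue A a].
Proof.
have pN0 : char_poly A != 0 by rewrite monic_neq0 ?char_poly_monic.
apply: contrapT => /(@infinite_set_fset _ _ n.+1)[X XA nX].
have := @max_poly_roots _ _ (enum_fset X) pN0.
have rX : all (root (char_poly A)) (enum_fset X).
  by apply/allP => a /XA/=; rewrite eigenvalue_root_char.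
by move=> /(_ rX (fset_uniq _)); rewrite size_char_poly ltnNge nX.
Qed.

Lemma eigenvalue_sym_exists (R : realType) n (A : 'M[R]_n) :
  (0 < n)%N -> A^T = A -> exists a, eigenvalue A a.
Proof.
move=> n0 Asym; pose C : numClosedFieldType := complex R.
pose f : {rmorphism R -> C} := real_complex R.
pose B := map_mx f A.
have Breal : B \is a realmx.
  apply/mxOverP => i j; rewrite mxE; apply/complex_realP.
  by exists (A i j).
have Bherm : B \is hermsymmx.
  apply: realsym_hermsym => //; apply/is_hermitianmxP.
  rewrite expr0 scale1r map_mx_id// /B.
  by rewrite map_trmx Asym.
have /hermitian_normalmx/orthomx_spectralP Beq := Bherm.
have /mxOverP dreal := hermitian_spectral_diag_real Bherm.
have [a aB] := eigenvalue_closed B n0.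
have /eigenvalueP[v vB vN0] := aB.
have areal : a \is Num.real.
  set P := spectralmx B in Beq *; set d := spectral_diag B in Beq dreal *.
  have Punit : P \in unitmx by exact: spectral_unit.
  pose w := v *m invmx P.
  have wN0 : w != 0.
    apply: contra_neq vN0 => w0.
    by rewrite -[v](mulmxKV Punit) -/w w0 mul0mx.
  have wd : w *m diag_mx d = a *: w.
    by rewrite /w scalemxAl -vB [in RHS]Beq !mulmxA mulmxK.
  move: w wN0 wd => w wN0 wd; have [j wj] : exists j, w 0 j != 0.
    by apply/rV0Pn.
  move/rowP/(_ j): wd; rewrite mul_mx_diag !mxE [RHS]mulrC => /(mulfI wj) <-.
  exact: dreal.
have /complex_realP[k ak] := areal.
exists k; move: aB; rewrite !eigenvalue_root_char /B -map_char_poly ak.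
by rewrite (fmorph_root f).
Qed.

Lemma signless_laplacian_sym (R : realType) (G : sgraph) :
  (signless_laplacian R G)^T = signless_laplacian R G.
Proof.
rewrite /signless_laplacian linearD/= tr_diag_mx; congr (_ + _).
by apply/matrixP => i j; rewrite !mxE edge_sym.
Qed.

Lemma qradP (R : realType) (G : sgraph) : (0 < #|G|)%N ->
  eigenvalue (signless_laplacian R G) (qrad R G) /\
  forall a, eigenvalue (signless_laplacian R G) a -> a <= qrad R G.
Proof.
move=> G0; have [|/= eigq maxq] := setmaxP (@finite_eigenvalue R _ (signless_laplacian R G)).
  exact: eigenvalue_sym_exists (signless_laplacian_sym R G).
by split => // a /maxq.
Qed.

Lemma ex_qP (R : realType) (n : nat) (F : sgraph) (x y : F) : x -- y ->
  (exists G : sgraph, [/\ #|G| = n, free_of F G & ex_q R n F = qrad R G]) /\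
  forall G : sgraph, #|G| = n -> free_of F G -> qrad R G <= ex_q R n F.
Proof.
move=> xy.
pose S := [set r | exists G : sgraph, [/\ #|G| = n, free_of F G & r = qrad R G]].
have finS : finite_set S.
  pose h (M : 'M['I_n.+1]_n) : R :=
    setmax [set a | eigenvalue (map_mx (fun i : 'I_n.+1 => (i : nat)%:R) M) a].
  apply: (@sub_finite_set _ _ (h @` setT)); last exact/finite_image/finite_finset.
  move=> _ [G [Gn _ ->]]; case: _ / Gn @h => h.
  pose e (i j : 'I_#|G|) : nat :=
    ((i == j) * degree (enum_val i) + (enum_val i -- enum_val j))%N.
  exists (\matrix_(i, j) inord (e i j)) => //.
  rewrite /h /qrad; suff -> : map_mx (fun i : 'I_#|G|.+1 => (i : nat)%:R)
      (\matrix_(i, j) inord (e i j)) = signless_laplacian R G by [].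
  apply/matrixP => i j; rewrite !mxE inordK; last first.
    rewrite ltnS /e; have [<-|ij] := eqVneq i j.
      by rewrite edge_irr addn0 mul1n max_card.
    by rewrite mul0n add0n (leq_trans (leq_b1 _))// (leq_trans _ (ltn_ord i)).
  by rewrite /e natrD; have [<-|] := eqVneq i j; rewrite ?mul1n ?mulr1n.
have [|[G [Gn FG qG]] maxq] := setmaxP finS.
- pose irr0 : irreflexive (fun _ _ : 'I_n => false) := fun _ => erefl.
  exists (qrad R (@SGraph 'I_n (fun _ _ => false) (fun _ _ => erefl) irr0)).
  eexists; split; [|  | reflexivity]; first exact: card_ord.
  by case=> f _ /(_ x y xy).
split; first by exists G.
by move=> H Hn FH; apply: maxq; exists H.
Qed.

(* Main.v *)
(** Scaling by the degrees gives q(G) <= max_v (d_v + m_v), where m_v is the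
    average degree of the neighbours of v.  In an F-free graph with F bipartite,
    a vertex with d_v <= eps n contributes at most eps n + n, and a vertex with
    d_v > eps n has m_v <= eps n for large n by Kovari-Sos-Turan; hence
    q(G) <= (1 + eps) n.  The star on n vertices, with q = n, is F-free unless F
    is a star plus isolated vertices.  For F = K_{1,t}, being F-free means
    having maximum degree at most t - 1, so q <= 2 (t - 1), with equality for
    K_t plus isolated vertices. *)

Require Import Defs.
From mathcomp Require Import all_boot all_order all_algebra.
From mathcomp Require Import all_classical all_reals all_analysis.
From mathcomp Require Import lra.

Import Order.TTheory GRing.Theory Num.Theory.
Import numFieldNormedType.Exports.

Local Open Scope ring_scope.

Set Implicit Arguments.
Unset Strict Implicit.
Unset Printing Implicit Defensive.

(** * Spectral bounds for the signless Laplacian *)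

Lemma mul_row_signless_laplacian (R : realType) (G : sgraph) (x : G -> R) j :
  (\row_i x (enum_val i) *m signless_laplacian R G) 0 j =
  (degree (enum_val j))%:R * x (enum_val j) +
  \sum_(u | enum_val j -- u) x u.
Proof.
rewrite mulmxDr mxE; congr (_ + _).
  by rewrite mul_mx_diag !mxE mulrC.
rewrite mxE (reindex (@enum_val G G)) /=; last exact/onW_bij/enum_val_bij.
rewrite [RHS]big_mkcond /=; apply: eq_bigr => i _; rewrite !mxE edge_sym.
by case: (_ -- _); rewrite ?mulr1 ?mulr0.
Qed.

(** Eigenvectors become functions on vertices, so later arguments avoid the enumeration of [G]. *)
Lemma eigenvalue_signless_laplacianP (R : realType) (G : sgraph) (a : R) :
  reflect (exists2 x : G -> R, exists v, x v != 0 &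
             forall v, (degree v)%:R * x v + \sum_(u | v -- u) x u = a * x v)
          (eigenvalue (signless_laplacian R G) a).
Proof.
apply: (iffP eigenvalueP) => [[y yQ /rV0Pn[i yi]]|[x [v xv] xQ]].
  pose x u := y 0 (enum_rank u).
  have yE : y = \row_i x (enum_val i).
    by apply/rowP => j; rewrite mxE /x enum_valK.
  exists x; first by exists (enum_val i); rewrite /x enum_valK.
  move=> v; have := mul_row_signless_laplacian x (enum_rank v).
  by rewrite -yE yQ mxE enum_rankK => <-.
exists (\row_i x (enum_val i)).
  by apply/rowP => j; rewrite mul_row_signless_laplacian xQ !mxE.
by apply/rV0Pn; exists (enum_rank v); rewrite mxE enum_rankK.
Qed.

(* The bound is read off at a vertex where |x v| / w v is maximal, for an
   eigenvector x. *)
Lemma eigenvalue_signless_laplacian_le (R : realType) (G : sgraph)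
    (w : G -> R) (b a : R) :
  (forall v, 0 < w v) ->
  (forall v, (degree v)%:R * w v + \sum_(u | v -- u) w u <= b * w v) ->
  eigenvalue (signless_laplacian R G) a -> a <= b.
Proof.
move=> w0 wb /eigenvalue_signless_laplacianP[x [v0 xv0] xQ].
pose v := [arg max_(v > v0) (`|x v| / w v)]%O.
have vmax u : `|x u| / w u <= `|x v| / w v.
  by rewrite /v; case: arg_maxP => //= i _; apply.
set c := `|x v| / w v in vmax.
have xle u : `|x u| <= c * w u by rewrite -ler_pdivrMr// vmax.
have cgt0 : 0 < c.
  by apply: lt_le_trans (vmax v0); rewrite divr_gt0 ?normr_gt0.
have xvE : `|x v| = c * w v by rewrite /c divfK// gt_eqF.
rewrite -(ler_pM2r (w0 v)) -(ler_pM2l cgt0).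
apply: le_trans (ler_wpM2l (ltW cgt0) (wb v)).
rewrite mulrCA -xvE (le_trans (ler_wpM2r (normr_ge0 _) (ler_norm a)))//.
rewrite -normrM -xQ (le_trans (ler_normD _ _))// normrM normr_nat.
rewrite mulrDr mulrCA -xvE lerD2l mulr_sumr (le_trans (ler_norm_sum _ _ _))//.
exact: ler_sum.
Qed.

Lemma qrad_le (R : realType) (G : sgraph) (w : G -> R) (b : R) :
  (0 < #|G|)%N -> (forall v, 0 < w v) ->
  (forall v, (degree v)%:R * w v + \sum_(u | v -- u) w u <= b * w v) ->
  qrad R G <= b.
Proof.
by move=> G0 w0 wb; apply: (eigenvalue_signless_laplacian_le w0 wb);
  case: (qradP R G0).
Qed.

Lemma qrad_ge (R : realType) (G : sgraph) (x : G -> R) (v : G) (a : R) :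
  x v != 0 ->
  (forall v, (degree v)%:R * x v + \sum_(u | v -- u) x u = a * x v) ->
  a <= qrad R G.
Proof.
move=> xv xQ; have G0 : (0 < #|G|)%N by apply/card_gt0P; exists v.
case: (qradP R G0) => _; apply.
by apply/eigenvalue_signless_laplacianP; exists x => //; exists v.
Qed.

(** An edgeless graph is 1-colorable. The edge obtained is what [ex_qP] asks for. *)
Lemma chromatic_number2_edge (F : sgraph) :
  chromatic_number F = 2%N -> exists x y : F, x -- y.
Proof.
rewrite /chromatic_number; case: ex_minnP => k _ kmin k2; subst k.
apply: contrapT => noedge.
suff /kmin : colorable F 1 by [].
apply/existsP; exists [ffun=> ord0]; apply/forallP => x; apply/forallP => y.
by apply/implyP => xy; case: noedge; exists x, y.
Qed.

(** * Isomorphism, containment and stars *)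

Lemma isomorphic_sym (F G : sgraph) : isomorphic F G -> isomorphic G F.
Proof.
move=> [f [g fK gK] fe]; exists g; first by exists f.
by move=> x y; rewrite -fe !gK.
Qed.

Lemma isomorphic_contains (F G H : sgraph) :
  isomorphic F G -> contains H G -> contains H F.
Proof.
move=> [f /bij_inj finj fe] [g ginj ge].
exists (g \o f); first exact: inj_comp.
by move=> x y xy /=; apply: ge; rewrite fe.
Qed.

Lemma contains_star (G : sgraph) (v : G) t :
  (t <= degree v)%N -> contains G (star t).
Proof.
move=> tv; pose N := [pred y | v -- y].
have adj (i : 'I_t) : v -- enum_val (widen_ord tv i : 'I_#|N|).
  by have := enum_valP (widen_ord tv i : 'I_#|N|).
exists (fun x => match x with inl _ => v
                 | inr i => enum_val (widen_ord tv i : 'I_#|N|) end).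
- move=> [i|i] [j|j] //=; first by rewrite (ord1 i) (ord1 j).
  + by move=> vE; have := adj j; rewrite -vE edge_irr.
  + by move=> vE; have := adj i; rewrite vE edge_irr.
  + by move=> /enum_val_inj /(congr1 val) /= ij; congr inr; apply: val_inj.
- by move=> [i|i] [j|j] //= _; rewrite 1?edge_sym adj.
Qed.

Lemma contains_star_degree (G : sgraph) t :
  contains G (star t) -> exists v : G, (t <= degree v)%N.
Proof.
move=> [f finj fe]; exists (f (inl ord0)).
have rinj : injective (fun i : 'I_t => f (inr i)) by move=> i j /finj[].
rewrite -[leqLHS](card_ord t) -(fintype.card_image rinj).
by apply: subset_leq_card; apply/fintype.subsetP => _ /fintype.imageP[i _ ->]; apply: fe.
Qed.

(** * Extremal value for stars *)

Section CliqueWithIsolated.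
Variables s t : nat.

Definition clique_isolated_edge (x y : 'I_t + 'I_s) : bool :=
  match x, y with inl i, inl j => i != j | _, _ => false end.

Lemma clique_isolated_sym : symmetric clique_isolated_edge.
Proof. by case=> ? [] //= ?; rewrite eq_sym. Qed.

Lemma clique_isolated_irr : irreflexive clique_isolated_edge.
Proof. by case=> //= ?; rewrite eqxx. Qed.

Definition clique_isolated : sgraph :=
  SGraph clique_isolated_sym clique_isolated_irr.

Lemma degree_clique_isolated (v : clique_isolated) :
  degree v = if v is inl _ then t.-1 else 0%N.
Proof.
rewrite /degree -sum1_card big_sumType /=; case: v => [i|i] /=.
  rewrite [X in (_ + X)%N]big_pred0 // addn0 sum1_card.
  by rewrite -[t in RHS]card_ord -(cardC1 i); apply: eq_card => j;
    rewrite !inE eq_sym.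
by rewrite !big_pred0.
Qed.

End CliqueWithIsolated.

Lemma ex_q_star (R : realType) (F : sgraph) (x y : F) t n :
  x -- y -> isomorphic F (star t) -> (t <= n)%N ->
  ex_q R n F = 2 * (t%:R - 1).
Proof.
move=> xy isoF tn.
(* [star 0] has no edge, whereas [F] has one. *)
have t0 : (0 < t)%N.
  case: t isoF {tn} => // -[f _ fe]; move: xy; rewrite -fe.
  by case: (f x) (f y) => [?|[]//] [?|[]//].
have predt : t.-1%:R = t%:R - 1 :> R by rewrite -subn1 natrB.
have [[G [Gn FG ->]] ex_ge] := ex_qP R n xy.
apply/eqP; rewrite eq_le; apply/andP; split.
  (* With constant weight the bound at [v] is twice its degree. *)
  apply: (qrad_le (w := fun=> 1)) => //; first by rewrite Gn (leq_trans t0).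
  move=> v; rewrite sumr_const !mulr1 -[X in _ + X]/((degree v)%:R).
  have : (degree v)%:R <= t%:R - 1 :> R; last by lra.
  rewrite -predt ler_nat -ltnS prednK// ltnNge; apply/negP => /contains_star.
  by move/(isomorphic_contains isoF)/FG.
pose H := clique_isolated (n - t) t.
have Hn : #|H| = n by rewrite card_sum !card_ord subnKC.
have FH : free_of F H.
  move=> /(isomorphic_contains (isomorphic_sym isoF)) /contains_star_degree[v].
  rewrite degree_clique_isolated; case: v => _; last by rewrite leqNgt t0.
  by rewrite leqNgt prednK // leqnn.
apply: le_trans (ex_ge H Hn FH).
(* The indicator of the clique is an eigenvector: degree and neighbour sum are both [t - 1]
   there. *)
pose z : H -> R := fun v => if v is inl _ then 1 else 0.
apply: (@qrad_ge _ _ z (inl (Ordinal t0))); first exact: oner_neq0.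
move=> v; rewrite degree_clique_isolated big_sumType /= [X in _ + (_ + X)]big1//.
case: v => [i|i] /=; last by rewrite big_pred0// !mulr0 !addr0.
rewrite addr0 !mulr1 sumr_const.
have -> : #|[pred j : 'I_t | i != j]| = t.-1.
  by rewrite -[t in RHS]card_ord -(cardC1 i); apply: eq_card => j;
    rewrite !inE eq_sym.
rewrite predt; lra.
Qed.

(** * Lower bound from large stars *)

(** An embedding into a star sends every edge of [F] to one through the centre, so all edges of [F]
    share a vertex [c]. Thus [F] is a star at [c], with the non-neighbours of [c] isolated. *)
Lemma free_of_star (F : sgraph) (x y : F) m :
  x -- y -> ~ star_upto_isolated F -> free_of F (star m).
Proof.
move=> xy nstar [f finj fe]; apply: nstar.
have [c fc] : exists c, f c = inl ord0.
  have := fe _ _ xy; case fx: (f x) => [i|i]; case fy: (f y) => [j|j] // _.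
    by exists x; rewrite fx (ord1 i).
  by exists y; rewrite fy (ord1 j).
have ec u v : u -- v -> (u == c) || (v == c).
  move=> /fe; case fu: (f u) => [i|i]; case fv: (f v) => [j|j] // _.
    by apply/orP; left; apply/eqP/finj; rewrite fu fc (ord1 i).
  by apply/orP; right; apply/eqP/finj; rewrite fv fc (ord1 j).
pose N := [pred u | c -- u]; pose M := [pred u | (u != c) && ~~ (c -- u)].
pose g (z : add_isolated (star #|N|) #|M|) : F :=
  match z with
  | inl (inl _) => c
  | inl (inr i) => enum_val (i : 'I_#|N|)
  | inr j => enum_val (j : 'I_#|M|)
  end.
have gN (i : 'I_#|N|) : c -- enum_val i by have := enum_valP i.
have gM (i : 'I_#|M|) : (enum_val i != c) && ~~ (c -- enum_val i).
  by have := enum_valP i.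
have ginj : injective g.
  move=> [[i|i]|i] [[j|j]|j] //=.
  - by rewrite (ord1 i) (ord1 j).
  - by move=> E; have := gN j; rewrite -E edge_irr.
  - by move=> E; have := gM j; rewrite -E eqxx.
  - by move=> E; have := gN i; rewrite E edge_irr.
  - by move=> /enum_val_inj ->.
  - by move=> E; have := gM j; rewrite -E gN andbF.
  - by move=> E; have := gM i; rewrite E eqxx.
  - by move=> E; have := gM i; rewrite E gN andbF.
  - by move=> /enum_val_inj ->.
have gbij : bijective g.
  (* The cardinality bound comes from surjectivity: each vertex is [c], in [N] or in [M]. *)
  apply: inj_card_bij => //; apply: leq_trans (leq_image_card g _).
  apply: subset_leq_card; apply/fintype.subsetP => u _; apply/fintype.imageP.
  have [->|uc] := eqVneq u c; first by exists (inl (inl ord0)).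
  have [cu|cu] := boolP (c -- u).
    by exists (inl (inr (enum_rank_in (A := N) cu u))); rewrite //= enum_rankK_in.
  have Mu : u \in M by rewrite !inE uc.
  by exists (inr (enum_rank_in Mu u)); rewrite //= enum_rankK_in.
exists #|N|, #|M|; apply: isomorphic_sym; exists g => //.
have Fedge u v : u != c -> v != c -> u -- v = false.
  by move=> uc vc; apply/negP => /ec; rewrite (negPf uc) (negPf vc).
have gNc (i : 'I_#|N|) : enum_val i != c.
  by apply/eqP => E; have := gN i; rewrite E edge_irr.
have gMc (i : 'I_#|M|) : enum_val i != c by case/andP: (gM i).
have gMe (i : 'I_#|M|) : c -- enum_val i = false.
  by apply/negbTE; case/andP: (gM i).
move=> [[i|i]|i] [[j|j]|j] /=.
- exact: edge_irr.
- exact: gN.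
- exact: gMe.
- by rewrite edge_sym; exact: gN.
- by rewrite Fedge.
- by rewrite Fedge.
- by rewrite edge_sym; exact: gMe.
- by rewrite Fedge.
- by rewrite Fedge.
Qed.

(** The vector with [m] at the centre and 1 at the leaves is an eigenvector: [m * m + m] at the
    centre, [1 + m] at a leaf. *)
Lemma qrad_star_ge (R : realType) m : (0 < m)%N -> m.+1%:R <= qrad R (star m).
Proof.
move=> m0; pose x (v : star m) : R := if v is inl _ then m%:R else 1.
apply: (@qrad_ge _ _ x (inl ord0)); first by rewrite /x pnatr_eq0 -lt0n.
have degE (v : star m) : degree v = (\sum_(u | v -- u) 1)%N.
  by rewrite /degree -sum1_card; apply: eq_bigl.
move=> v; rewrite degE !big_sumType /=; case: v => [i|i] /=.
  rewrite !big_pred0_eq add0n add0r sum_nat_const sumr_const card_ord muln1.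
  by rewrite -[m.+1]addn1 natrD mulrDl mul1r.
rewrite !big_pred0_eq !big_ord1 addn0 addr0 !mulr1.
by rewrite -[m.+1]addn1 natrD addrC.
Qed.

(** * Double counting, bicliques and degree sums *)

Lemma sum_card_rel (T : finType) (e : rel T) (A B : {set T}) :
  (\sum_(u in A) #|[set w in B | e u w]%SET| =
   \sum_(w in B) #|[set u in A | e u w]%SET|)%N.
Proof.
have cardE (C : {set T}) (p : pred T) :
    #|[set z in C | p z]%SET| = (\sum_(z in C) p z)%N.
  rewrite -sum1dep_card big_mkcondr /=; apply: eq_bigr => z _.
  by case: (p z).
under eq_bigr do rewrite cardE; rewrite exchange_big.
by under [RHS]eq_bigr do rewrite cardE.
Qed.

(* Greedy choice: some u in U is adjacent to a fraction d
   of W; remove it from U, restrict W to its neighbours, and iterate. *)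
Lemma dense_common_neighbours (R : realType) (G : sgraph) (d : R) s
    (U W : {set G}) : 0 < d -> (0 < #|W|)%N ->
  (forall w, w \in W ->
     d * #|U|%:R + s%:R <= #|[set u in U | u -- w]%SET|%:R) ->
  exists S : {set G}, [/\ S \subset U, #|S| = s &
    d ^+ s * #|W|%:R <= #|[set w in W | [forall u in S, u -- w]]%SET|%:R].
Proof.
move=> d0; elim: s U W => [|s IHs] U W W0 dW.
  exists finset.set0; split; rewrite ?finset.sub0set ?cards0// expr0 mul1r ler_nat.
  apply: subset_leq_card; apply/fintype.subsetP => w wW; rewrite inE wW /=.
  by apply/forall_inP => u; rewrite inE.
have [u uU du] : exists2 u, u \in U &
    d * #|W|%:R <= #|[set w in W | u -- w]%SET|%:R.
  (* Otherwise there are at most [d * #|U| * #|W|] adjacent pairs, while the hypothesis on each [w]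
     gives strictly more. *)
  apply: contrapT => no.
  have : \sum_(u in U) #|[set w in W | u -- w]%SET|%:R <=
      \sum_(u in U) d * #|W|%:R.
    apply: ler_sum => u uU; rewrite leNgt; apply/negP => /ltW du.
    by apply: no; exists u.
  rewrite -natr_sum sum_card_rel natr_sum leNgt => /negP; apply.
  apply: (@lt_le_trans _ _ (\sum_(w in W) (d * #|U|%:R + s.+1%:R))); last first.
    exact: ler_sum.
  rewrite !sumr_const -[ltLHS]mulr_natr -[ltRHS]mulr_natr mulrDl mulrAC ltrDl.
  by rewrite mulr_gt0 ?ltr0n.
have [||S [SU Ss dS]] := IHs (U :\ u)%SET [set w in W | u -- w]%SET.
- by rewrite -(ltr0n R); apply: lt_le_trans du; rewrite mulr_gt0 ?ltr0n.
(* Removing [u] costs [w] one neighbour, paid for by the drop from [s.+1] to [s]. *)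
- move=> w; rewrite inE => /andP[wW uw]; rewrite -(lerD2r 1).
  apply: le_trans (le_trans (dW w wW) _).
    rewrite -addrA -[s.+1]addn1 natrD lerD2r ler_pM2l// ler_nat.
    exact/subset_leq_card/finset.subD1set.
  rewrite (cardsD1 u) !inE uU uw natrD addrC lerD2r ler_nat.
  by apply: subset_leq_card; apply/fintype.subsetP => z; rewrite !inE andbA.
exists (u |: S)%SET; split.
- rewrite finset.subUset finset.sub1set uU.
  by rewrite (fintype.subset_trans SU)// finset.subD1set.
- by rewrite cardsU1 Ss; case: (boolP (u \in S)) => // /(fintype.subsetP SU);
    rewrite !inE eqxx.
rewrite exprSr -mulrA; apply: le_trans (ler_wpM2l (exprn_ge0 s (ltW d0)) du) _.
rewrite (le_trans dS)// ler_nat; apply: subset_leq_card.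
apply/fintype.subsetP => w; rewrite !inE => /andP[/andP[-> uw] /forall_inP Sw] /=.
by apply/forall_inP => z; rewrite !inE => /predU1P[->|/Sw].
Qed.

(** One side of [F] goes into [S], the other into [T]; the two images are disjoint because adjacency
    is irreflexive. *)
Lemma contains_biclique (F G : sgraph) (S T : {set G}) :
  bipartite F -> (#|F| <= #|S|)%N -> (#|F| <= #|T|)%N ->
  (forall u w, u \in S -> w \in T -> u -- w) -> contains G F.
Proof.
move=> [A bipA] FS FT ST.
pose fS (x : F) : G := enum_val (widen_ord FS (enum_rank x)).
pose fT (x : F) : G := enum_val (widen_ord FT (enum_rank x)).
have fST x y : fS x -- fT y by apply: ST; exact: enum_valP.
have fSTN x y : fS x <> fT y by move=> E; have := fST x y; rewrite E edge_irr.
exists (fun x => if x \in A then fS x else fT x).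
  move=> x y; case: ifP => _; case: ifP => _.
  - by move=> /enum_val_inj /(congr1 val) /= /val_inj /enum_rank_inj.
  - by move/fSTN.
  - by move/esym/fSTN.
  - by move=> /enum_val_inj /(congr1 val) /= /val_inj /enum_rank_inj.
move=> x y /bipA; case: (x \in A); case: (y \in A) => // _.
by rewrite edge_sym.
Qed.

(** This is the bound on d_v + m_v multiplied by d_v, which avoids dividing by zero at isolated
    vertices. *)
Lemma degree_sum_le (R : realType) (F : sgraph) (eps : R) :
  bipartite F -> 0 < eps -> exists N : nat, forall G : sgraph,
    (N <= #|G|)%N -> free_of F G -> forall v : G,
    (degree v)%:R * (degree v)%:R + \sum_(u | v -- u) (degree u)%:R
      <= (1 + eps) * #|G|%:R * (degree v)%:R :> R.
Proof.
move=> bipF eps0; set s := #|F|.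
(* [s <= c1 * n] gives [s <= eps / 4 * d] when [d > eps * n], the slack of the greedy choice;
   [s <= c2 * n] gives [s] common neighbours when [#|W| >= eps / 2 * n]. *)
pose c1 := eps / 4 * eps; pose c2 := (eps / 4) ^+ s * (eps / 2).
have c10 : 0 < c1 by rewrite mulr_gt0// divr_gt0.
have c20 : 0 < c2 by rewrite mulr_gt0 ?exprn_gt0// divr_gt0.
pose C := s%:R / c1 + s%:R / c2.
have s1 : 0 <= s%:R / c1 by rewrite divr_ge0// ltW.
have s2 : 0 <= s%:R / c2 by rewrite divr_ge0// ltW.
exists (Num.bound C) => G NG FG v; set n := #|G| in NG *; set d := degree v.
have Cn : C < n%:R.
  apply: lt_le_trans (archi_boundP _) _; first exact: addr_ge0.
  by rewrite ler_nat.
have c1n : s%:R <= c1 * n%:R.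
  by rewrite mulrC -ler_pdivrMr// (le_trans _ (ltW Cn))// lerDl.
have c2n : s%:R <= c2 * n%:R.
  by rewrite mulrC -ler_pdivrMr// (le_trans _ (ltW Cn))// lerDr.
have n0 : 0 < n%:R :> R by apply: le_lt_trans Cn; exact: addr_ge0.
have dn : d%:R <= n%:R :> R by rewrite ler_nat max_card.
rewrite mulrDl mul1r mulrDl.
have [d_small|d_large] := leP (d%:R : R) (eps * n%:R).
  rewrite addrC lerD//; last by rewrite ler_wpM2r.
  apply: (@le_trans _ _ (\sum_(u | v -- u) n%:R)).
    by apply: ler_sum => u _; rewrite ler_nat max_card.
  by rewrite sumr_const -[leLHS]mulr_natr.
rewrite lerD ?ler_wpM2r//.
pose U := [set u | v -- u]%SET.
have dU : d = #|U| by rewrite /d /degree; apply: eq_card => u; rewrite !inE.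
pose k w := #|[set u in U | u -- w]%SET|.
have kd w : (k w <= d)%N.
  by rewrite dU; apply: subset_leq_card; apply/fintype.subsetP => u; rewrite inE => /andP[].
(* The pairs (u, w) with u a neighbour of [v] are counted from the side of w. *)
have -> : \sum_(u | v -- u) (degree u)%:R = \sum_w (k w)%:R :> R.
  rewrite -!natr_sum; congr _%:R.
  have := sum_card_rel (@edge G) U [set: G]%SET; rewrite /k.
  under eq_bigl do rewrite inE; under [in RHS]eq_bigl do rewrite inE.
  move=> <-; apply: eq_bigr => u _; rewrite /degree; apply: eq_card => w.
  by rewrite !inE.
pose W := [set w | eps / 2 * d%:R <= (k w)%:R]%SET.
(* If [W] is small, its members contribute at most [d] each and the other vertices at most
   [eps / 2 * d] each. If [W] is large, a biclique appears. *)
have [W_large|W_small] := leP (eps / 2 * n%:R) (#|W|%:R); last first.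
  have kle w : true -> (k w)%:R <= (w \in W)%:R * d%:R + eps / 2 * d%:R.
    move=> _; rewrite inE; case: (leP (eps / 2 * d%:R)) => [_|/ltW] /=; last first.
      by rewrite mul0r add0r.
    by rewrite mulr1n mul1r ler_wpDr ?ler_nat ?kd// mulr_ge0// ltW// divr_gt0//.
  apply: le_trans (ler_sum _ kle) _.
  rewrite big_split /= -mulr_suml -natr_sum -big_mkcond sum1_card sumr_const.
  have -> : eps * n%:R * d%:R = eps / 2 * n%:R * d%:R + eps / 2 * d%:R * n%:R.
    by lra.
  by rewrite -[eps / 2 * d%:R *+ _]mulr_natr lerD2r ler_wpM2r// ltW.
have dlt0 : 0 < eps / 4 by rewrite divr_gt0.
have W0 : (0 < #|W|)%N.
  by rewrite -(ltr0n R); apply: lt_le_trans W_large; rewrite !mulr_gt0 ?invr_gt0.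
have [w|S [SU Ss ST]] := @dense_common_neighbours R G (eps / 4) s U W dlt0 W0.
  rewrite inE => kw; apply: le_trans kw; rewrite -dU.
  have : c1 * n%:R <= eps / 4 * d%:R by rewrite /c1 -mulrA ler_pM2l// ltW.
  by move: c1n; lra.
case: FG; apply: (contains_biclique bipF (S := S)) => [||u w uS].
- by rewrite Ss.
- rewrite -(ler_nat R); apply: le_trans c2n _; apply: le_trans ST.
  by rewrite /c2 -mulrA ler_pM2l ?exprn_gt0.
- by rewrite inE => /andP[_ /forall_inP]; apply.
Qed.

Lemma qrad_le_free (R : realType) (F : sgraph) (eps : R) :
  bipartite F -> 0 < eps -> exists N : nat, forall G : sgraph,
    (N <= #|G|)%N -> (0 < #|G|)%N -> free_of F G ->
    qrad R G <= (1 + eps) * #|G|%:R.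
Proof.
move=> bipF eps0; have [N HN] := degree_sum_le bipF eps0.
exists N => G NG G0 FG.
(* The weight 1 at isolated vertices keeps all weights positive; it does not
   occur in any neighbour sum. *)
pose w (v : G) : R := if degree v == 0%N then 1 else (degree v)%:R.
apply: (qrad_le (w := w)) => // v.
  by rewrite /w; case: eqP => // /eqP; rewrite ltr0n lt0n.
have -> : \sum_(u | v -- u) w u = \sum_(u | v -- u) (degree u)%:R.
  apply: eq_bigr => u vu; rewrite /w; case: eqP => // /card0_eq /(_ v).
  by rewrite inE edge_sym vu.
rewrite /w; case: eqP => [d0|_]; last exact: HN.
rewrite d0 mul0r add0r big_pred0; last by move=> u; have := card0_eq d0 u.
by rewrite mulr1 mulr_ge0// addr_ge0// ltW.
Qed.

(** * Asymptotics of the extremal value *)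

Local Open Scope classical_set_scope.

Theorem theorem1p5 (R : realType) (F : sgraph) :
  bipartite F -> chromatic_number F = 2%N ->
  (~ star_upto_isolated F ->
    exists2 eps : nat -> R, eps n @[n --> \oo] --> (0 : R) &
      \forall n \near \oo, ex_q R n F = (1 + eps n) * n%:R) /\
  (forall t : nat, isomorphic F (star t) ->
    forall n : nat, (t <= n)%N -> ex_q R n F = 2 * (t%:R - 1)).
Proof.
move=> bipF /chromatic_number2_edge[x [y xy]]; split; last first.
  by move=> t isoF n; apply: ex_q_star xy isoF.
(* The error term is solved from the required identity, leaving only its limit to prove. *)
move=> nstar; exists (fun n => ex_q R n F / n%:R - 1); last first.
  near=> n; rewrite addrC subrK divfK// pnatr_eq0 -lt0n.
  by near: n; exact: nbhs_infty_gt.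
apply/cvgrPdist_le => e e0; have [N HN] := @qrad_le_free R F e bipF e0.
near=> n.
have n1 : (1 < n)%N by near: n; exact: nbhs_infty_gt.
have Nn : (N <= n)%N by near: n; exact: nbhs_infty_ge.
have n0 : 0 < n%:R :> R by rewrite ltr0n (ltn_trans _ n1).
have [[G [Gn FG qG]] ex_ge] := ex_qP R n xy.
have ub : ex_q R n F / n%:R <= 1 + e.
  rewrite ler_pdivrMr// qG -Gn; apply: HN; rewrite ?Gn//.
  exact: ltn_trans n1.
(* The competitor is the star with [n.-1] leaves, on [n] vertices; [1 < n] ensures a leaf. *)
have lb : 1 <= ex_q R n F / n%:R.
  have nE : n.-1.+1 = n by rewrite prednK// (ltn_trans _ n1).
  rewrite ler_pdivlMr// mul1r -[in leLHS]nE.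
  apply: le_trans (qrad_star_ge R _) (ex_ge _ _ (free_of_star xy nstar)).
    by rewrite -ltnS nE.
  by rewrite card_sum !card_ord add1n.
by rewrite sub0r normrN ger0_norm ?subr_ge0// lerBlDl.
Unshelve. all: by end_near.
Qed.
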